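(* There exist a regularization parameter $\eta>0$ and an atomic splittable congestion game with three players, all of whose resource cost functions are polynomials with nonnegative coefficients and degree at most $6$, that has a regularized equilibrium $x^*\in\operatorname{relint}(K)$ which is locally unstable (i.e. not Lyapunov stable) under the Euclidean-regularized Frank--Wolfe dynamics $\dot x=\beta^\eta(F(x))-x$ on $K$.
   Context: Games. An atomic splittable congestion game with $n$ players is a tuple $(N,E,(K_i)_{i\in N},(c_e)_{e\in E})$ with $N=\{1,\dots,n\}$, a finite resource set $E$, nonempty convex compact strategy sets $K_i\subset\mathbb R_+^E$ ($\mathbb R_+=[0,\infty)$), and cost functions $c_e\in C^2(\mathbb R_+)$ with $c_e'(x)\ge0$ and $2c_e'(x)+xc_e''(x)\ge0$ for all $x\ge0$. Put $K:=\prod_iK_i$ and $\bar x_e:=\sum_{i\in N}x_{i,e}$ for $x\in K$. The marginal cost operator is $F_{i,e}(x):=c_e(\bar x_e)+x_{i,e}c_e'(\bar x_e)$. $\operatorname{relint}(K)$ is the relative interior of $K$. Dynamics. For $\eta>0$, $\beta^\eta(z)=(\beta_i^\eta(z_i))_{i\in N}$ with $\beta_i^\eta(z_i):=\arg\min_{y_i\in K_i}\{\langle z_i,y_i\rangle+\frac{\eta}{2}\|y_i\|^2\}$. A regularized equilibrium is a rest point of the dynamics, i.e. $x^*\in K$ with $x^*=\beta^\eta(F(x^* ))$. Lyapunov stability. $x^*$ is Lyapunov stable if for every neighbourhood $U$ of $x^*$ relative to $K$ there is a neighbourhood $V\subseteq U$ of $x^*$ relative to $K$ such that every solution with $x(0)\in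 V$ satisfies $x(t)\in U$ for all $t\ge0$. *)

(* Defs.v *)
(* MathComp-Analysis *)
From HB Require Import structures.
From mathcomp Require Import all_boot all_order all_algebra.
From mathcomp Require Import all_classical all_reals all_analysis.

Set Implicit Arguments.
Unset Strict Implicit.
Unset Printing Implicit Defensive.

Import Order.TTheory GRing.Theory Num.Theory.
Import numFieldNormedType.Exports.

Local Open Scope classical_set_scope.
Local Open Scope ring_scope.

(* Functions on the half-line [0, +oo[ are represented by functions on R whose
   values at negative arguments are never used: the increment h ranges over
   t + h >= 0, so that the derivative at 0 is the right derivative. *)
Definition is_derive_nneg (R : realType) (V : normedModType R)
    (f : R -> V) (t : R) (v : V) : Prop :=
  (fun h : R => h^-1 *: (f (t + h) - f t))
    @ within [set h : R | 0 <= t + h] (0 : R)^' --> v.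

Definition derivable_nneg (R : realType) (V : normedModType R)
    (f : R -> V) (t : R) : Prop :=
  exists v : V, is_derive_nneg f t v.

(* Meaningful where f is derivable_nneg, as with the library's 'D_v f. *)
Definition derive_nneg (R : realType) (V : normedModType R)
    (f : R -> V) (t : R) : V :=
  lim ((fun h : R => h^-1 *: (f (t + h) - f t))
    @ within [set h : R | 0 <= t + h] (0 : R)^').

(* Continuity of c and of its first derivative follows from derivability. *)
Definition C2_nneg (R : realType) (c : R -> R) : Prop :=
  [/\ forall x : R, 0 <= x -> derivable_nneg c x,
      forall x : R, 0 <= x -> derivable_nneg (derive_nneg c) x &
      {within [set x : R | 0 <= x], continuous (derive_nneg (derive_nneg c))}].

(* Players are 'I_n and resources are 'I_m; a strategy is a row vector. *)
Record splittable_game (R : realType) (n m : nat) := SplittableGame {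
  strat : 'I_n -> set 'rV[R]_m;
  cost : 'I_m -> R -> R;
  strat_nonempty : forall i, strat i !=set0;
  strat_convex : forall i, convex_set (strat i);
  strat_compact : forall i, compact (strat i);
  strat_nneg : forall i y e, strat i y -> 0 <= y 0 e;
  cost_C2 : forall e, C2_nneg (cost e);
  cost_derive_ge0 : forall e (x : R), 0 <= x -> 0 <= derive_nneg (cost e) x;
  cost_marginal : forall e (x : R), 0 <= x ->
    0 <= 2 * derive_nneg (cost e) x
         + x * derive_nneg (derive_nneg (cost e)) x
}.

(* A strategy profile is the n x m matrix whose i-th row is player i's strategy. *)
Definition profiles (R : realType) (n m : nat) (G : splittable_game R n m)
    : set 'M[R]_(n, m) :=
  [set x | forall i, strat G i (row i x)].

Definition load (R : realType) (n m : nat) (x : 'M[R]_(n, m)) (e : 'I_m) : R :=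
  \sum_(i < n) x i e.

Definition marginal_cost (R : realType) (n m : nat) (G : splittable_game R n m)
    (x : 'M[R]_(n, m)) : 'M[R]_(n, m) :=
  \matrix_(i, e)
    (cost G e (load x e) + x i e * derive_nneg (cost G e) (load x e)).

(* The library norm on row vectors is the sup norm, so the Euclidean structure
   is given by this inner product. *)
Definition dotv (R : realType) (m : nat) (u v : 'rV[R]_m) : R :=
  \sum_(e < m) u 0 e * v 0 e.

Definition argmin (R : realType) (T : Type) (A : set T) (f : T -> R) : set T :=
  [set y | A y /\ forall y', A y' -> f y <= f y'].

(* The argmin is a singleton for eta > 0, as each strat G i is nonempty, convex
   and compact; the default value 0 of xget is then irrelevant. *)
Definition regularized_br_player (R : realType) (n m : nat)
    (G : splittable_game R n m) (eta : R) (i : 'I_n) (z : 'rV[R]_m)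
    : 'rV[R]_m :=
  xget 0 (argmin (strat G i) (fun y => dotv z y + eta / 2 * dotv y y)).

Definition regularized_br (R : realType) (n m : nat)
    (G : splittable_game R n m) (eta : R) (z : 'M[R]_(n, m)) : 'M[R]_(n, m) :=
  \matrix_(i < n) regularized_br_player G eta i (row i z).

Definition regularized_equilibrium (R : realType) (n m : nat)
    (G : splittable_game R n m) (eta : R) (x : 'M[R]_(n, m)) : Prop :=
  profiles G x /\ x = regularized_br G eta (marginal_cost G x).

Definition FW_solution (R : realType) (n m : nat) (G : splittable_game R n m)
    (eta : R) (x : R -> 'M[R]_(n, m)) : Prop :=
  forall t : R, 0 <= t ->
    profiles G (x t) /\
    is_derive_nneg x t (regularized_br G eta (marginal_cost G (x t)) - x t).

Definition rel_nbhs (T : topologicalType) (A : set T) (x : T) (U : set T)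
    : Prop :=
  U `<=` A /\ within A (nbhs x) U.

Definition lyapunov_stable (R : realType) (n m : nat)
    (G : splittable_game R n m) (eta : R) (xs : 'M[R]_(n, m)) : Prop :=
  forall U : set 'M[R]_(n, m), rel_nbhs (profiles G) xs U ->
    exists V : set 'M[R]_(n, m), [/\ rel_nbhs (profiles G) xs V, V `<=` U &
      forall x : R -> 'M[R]_(n, m), FW_solution G eta x -> V (x 0) ->
        forall t : R, 0 <= t -> U (x t)].

Definition affine_hull (R : realType) (V : normedModType R) (A : set V)
    : set V :=
  [set x | exists (k : nat) (w : 'I_k -> R) (p : 'I_k -> V),
    [/\ forall j, A (p j), \sum_(j < k) w j = 1 &
        x = \sum_(j < k) w j *: p j]].

Definition relint (R : realType) (V : normedModType R) (A : set V) : set V :=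
  [set x | A x /\ \forall y \near x, affine_hull A y -> A y].

(* Main.v *)
Require Import Defs.
From mathcomp Require Import all_boot all_order all_algebra.
From mathcomp Require Import all_classical all_reals all_analysis.
From mathcomp Require Import ring lra.
Import Order.TTheory GRing.Theory Num.Theory.
Import numFieldNormedType.Exports.
Local Open Scope classical_set_scope.
Local Open Scope ring_scope.

(** The instability is already visible on one line.  Every player owns a segment
of strategies [a_i + s b_i], [-1 <= s <= 1], and the game is invariant under
cyclic shifts of players and of three resources, so the diagonal, where all
players use the same parameter [s], is invariant and carries a scalar equation
[s' = clip (g s) - s]; here [- g s] is, up to a positive factor, the marginal
cost of a player in the direction [b_i], and [clip] projects onto [[-1, 1]].
The rest point [s = 0] repels as soon as [g s > s] for small [s > 0], that is,
as soon as moving together in the direction [b_i] lowers everybody's marginal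
cost steeply enough.

Very convex costs make this possible.  Each of the three resources is used
almost exclusively by one player, its owner, who withdraws one unit while the
two others each add one.  The total load increases by one, but the owner's load
multiplies [c'] in his own marginal cost, and he is the one who gains from the
larger [c'] when he leaves.  With cost [x^d] and load [P] borne by the owner
alone, one resource contributes [d P^(d-1) (5 - d)] to the derivative of the sum
of the directional marginal costs, where [5 - d = 1 + 3 - (d - 1)]: 1 is the
square of the load increment, 3 the squared length of [(-1, 1, 1)], and
[-(d - 1)] comes from the owner's load times [c''].  This is negative from
[d = 6] on.  Owners at 40 and guests at 1 are close enough to this limit.  A
fourth resource of constant cost makes [s = 0] an exact rest point.

The equation [s' = clip (g s) - s] is solved by inverting the time
[T s = \int du / (clip (g u) - u)] (lemma [scalar_flow]).  Since the right-hand
side is at most [1 - s], this time diverges logarithmically at [s = 1], which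
makes the solution global, while every level below 1 is reached in finite time.
So arbitrarily small positive [s] grow to [1/2] (lemma [diagonal_unstable]). *)

(** * A scalar autonomous equation solved by inverting time *)

Lemma is_derive_primitive {R : realType} {f : R -> R} (a b : R) {x : R} :
  {within `[a, b], continuous f} -> a < x < b ->
  is_derive x 1 (fun y => \int[lebesgue_measure]_(t in `[a, y]) f t)%R (f x).
Proof.
move=> cf /andP[ax xb].
have fi : lebesgue_measure.-integrable `[a, b] (EFin \o f).
  by apply: continuous_compact_integrable => //; exact: segment_compact.
have cfx : {for x, continuous f}.
  have /(continuous_within_itvP f)[/(_ cf)[cf' _ _] _] := lt_trans ax xb.
  by apply: cf'; rewrite in_itv/= ax.
have [df f'] := continuous_FTC1_closed xb fi ax cfx.
exact: DeriveDef df (etrans (esym (derive1E _ _)) f').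
Qed.

(** The mean value theorem for a function differentiable on an open interval
only: the time function below has no value at the right end 1. *)
Lemma open_MVT {R : realType} {f df : R -> R} {a b x y : R} :
  (forall u, a < u < b -> is_derive u 1 f (df u)) ->
  a < x -> x < y -> y < b ->
  exists2 c, a < c < b & f y - f x = df c * (y - x).
Proof.
move=> fd ax xy yb.
have inab z : x <= z <= y -> a < z < b.
  by move=> /andP[xz zy]; rewrite (lt_le_trans ax)//= (le_lt_trans zy).
have [||c /[!in_itv]/= /andP[xc cy] E] := @MVT R f df x y xy.
- move=> z /[!in_itv]/= /andP[xz zy]; apply: fd.
  by rewrite inab// !ltW.
- apply: derivable_within_continuous => z /[!in_itv]/= /inab zab.
  exact: (@ex_derive _ _ _ _ _ _ _ (fd z zab)).
by exists c => //; rewrite inab// !ltW.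
Qed.

(** Separation of variables: the solution is the inverse of
[T x = \int_s0^x du / F u].  The bound [F u <= 1 - u] gives
[T x >= ln (1 - s0) - ln (1 - x)], so [T] maps [[s0, 1[] onto [[0, +oo[], and
the inverse is defined for all times.  The last conclusion says that the
solution climbs through every level below 1. *)
Lemma scalar_flow {R : realType} {F : R -> R} {s0 : R} :
  continuous F -> (forall u, 0 < u < 1 -> 0 < F u <= 1 - u) ->
  0 < s0 < 1 ->
  exists s : R -> R, [/\ s 0 = s0,
    forall t, 0 <= t -> 0 < s t < 1 /\ is_derive t 1 s (F (s t)) &
    forall v, s0 <= v < 1 -> exists2 t, 0 <= t & s t = v].
Proof.
move=> cF F01 /andP[s0_gt0 s0_lt1].
(* The integral starts below [s0], so that [T] is increasing on both sides of
   [s0] and its inverse has a two-sided derivative at time 0. *)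
pose a := s0 / 2.
have a0 : 0 < a by rewrite /a; lra.
have as0 : a < s0 by rewrite /a; lra.
have inI u : a < u < 1 -> 0 < u < 1.
  by move=> /andP[au ->]; rewrite (lt_trans a0).
pose T0 y := (\int[lebesgue_measure]_(t in `[a, y]) (F t)^-1)%R.
have T0d x : a < x < 1 -> is_derive x 1 T0 (F x)^-1.
  move=> /andP[ax x1].
  apply: (is_derive_primitive (f := fun t => (F t)^-1) a ((x + 1) / 2)).
    apply: continuous_in_subspaceT => u /set_mem/=; rewrite in_itv/= => /andP[au' ux].
    have u01 : 0 < u < 1 by rewrite (lt_le_trans a0)//= (le_lt_trans ux)//; lra.
    apply: continuousV; last exact: cF.
    by rewrite gt_eqF//; have [] := andP (F01 u u01).
  lra.
pose T y := T0 y - T0 s0.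
have Ts0 : T s0 = 0 by rewrite /T subrr.
have Td x : a < x < 1 -> is_derive x 1 T (F x)^-1.
  move=> /T0d h; rewrite -[_^-1]subr0; apply: is_deriveB.
have Finv_gt0 u : a < u < 1 -> 0 < (F u)^-1.
  by move=> au; rewrite invr_gt0; have [] := andP (F01 u (inI u au)).
have Tinc x y : a < x -> x < y -> y < 1 -> T x < T y.
  move=> ax xy y1; have [c c1 E] := open_MVT Td ax xy y1.
  by rewrite -subr_gt0 E mulr_gt0 ?Finv_gt0// subr_gt0.
have Tinj x y : a < x < 1 -> a < y < 1 -> T x = T y -> x = y.
  move=> /andP[ax x1] /andP[ay y1] e; apply/eqP; case: ltgtP => // h.
    by have := Tinc _ _ ax h y1; rewrite e ltxx.
  by have := Tinc _ _ ay h x1; rewrite e ltxx.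
have Tlog y : s0 < y -> y < 1 -> ln (1 - s0) - ln (1 - y) <= T y.
  move=> sy y1.
  have [|c c1 E] := @open_MVT _ (fun u => T u + ln (1 - u))
    (fun u => (F u)^-1 - (1 - u)^-1) a 1 s0 y _ as0 sy y1.
    move=> u uab; apply: is_deriveD; first exact: Td.
    have u1 : 0 < 1 - u by lra.
    have := is_derive1_comp (f := @ln R) (g := cst 1 - id) (is_derive1_ln u1)
      (is_deriveB (is_derive_cst (1 : R) u 1) (is_derive_id u 1)).
    by rewrite sub0r mulrN mulr1.
  rewrite -subr_ge0; have -> : T y - (ln (1 - s0) - ln (1 - y)) =
      T y + ln (1 - y) - (T s0 + ln (1 - s0)) by rewrite Ts0; ring.
  have /andP[F0 F1] : 0 < F c <= 1 - c by exact/F01/inI.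
  rewrite E mulr_ge0// ?subr_ge0 ?(ltW sy)// lef_pV2 ?posrE//; lra.
have cT x y : a < x -> y < 1 -> {within `[x, y], continuous T}.
  move=> ax y1; apply: derivable_within_continuous => z /[!in_itv]/= /andP[xz zy].
  by apply: (@ex_derive _ _ _ _ _ _ _ (Td z _)); lra.
have Tsurj t : 0 <= t -> exists2 x, s0 <= x < 1 & T x = t.
  (* The extra [- 1] in the exponent keeps [y] strictly above [s0] at [t = 0]. *)
  move=> t0; pose y := 1 - (1 - s0) * expR (- t - 1).
  have e0 : 0 < expR (- t - 1) :> R by exact: expR_gt0.
  have e1 : expR (- t - 1) < 1 :> R by rewrite expR_lt1; lra.
  have y1 : y < 1 by rewrite /y; nra.
  have sy : s0 < y by rewrite /y; nra.
  have Ty : t <= T y.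
    have E : 1 - y = (1 - s0) * expR (- t - 1) by rewrite /y; ring.
    have := Tlog _ sy y1; rewrite E lnM ?posrE ?expRK//; lra.
  have [|x /[!in_itv]/= xin Tx] := IVT (v := t) (ltW sy) (cT _ _ as0 y1).
    by rewrite Ts0 min_l ?max_r ?(le_trans t0)// t0.
  by exists x => //; lra.
pose s t := xget s0 [set x | a < x < 1 /\ T x = t].
have sK x : a < x < 1 -> s (T x) = x.
  move=> x1; rewrite /s; case: xgetP => [_ -> [] h e|/(_ x)[]//].
  exact: Tinj.
exists s; split.
- by rewrite -Ts0 sK//; lra.
- move=> _ /Tsurj[x x1 <-]; have ax : a < x < 1 by lra.
  rewrite sK//; split; first lra.
  rewrite -[F x]invrK.
  have nx : \forall z \near x, a < z < 1.
    by have : x \in `]a, 1[ := ax; move=> /near_in_itvoo; apply: filterS => z /[!in_itv].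
  apply: is_derive_inverse.
  + by apply: filterS nx => z /sK.
  + apply: filterS nx => z /Td dz.
    by apply/differentiable_continuous/derivable1_diffP/(@ex_derive _ _ _ _ _ _ _ dz).
  + exact: Td.
  + by rewrite gt_eqF// Finv_gt0.
- move=> v v1; exists (T v); last by apply: sK; lra.
  rewrite -Ts0; case: (ltgtP s0 v) v1 => [h|//|<-//] /= v1.
  by apply/ltW/Tinc.
Qed.

(** * Derivatives on the half-line *)

(** Limits of difference quotients along [0 <= t + h] are unique also at [t = 0],
since positive increments are always admissible. *)
Lemma within_nneg_proper {R : realType} {t : R} :
  0 <= t -> ProperFilter (within [set h : R | 0 <= t + h] (0 : R)^').
Proof.
move=> t0; apply: Build_ProperFilter => w0.
suff /filter_ex[] : \forall h \near (0 : R)^'+, False by [].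
apply: filterS (w0 : nbhs (0 : R) [set h | h != 0 -> 0 <= t + h -> False]).
move=> h hA h0.
by apply: hA; [rewrite gt_eqF | rewrite /= addr_ge0// ltW].
Qed.

Lemma derive_nneg_val {R : realType} {V : normedModType R} {f : R -> V}
    {t : R} {v : V} :
  0 <= t -> is_derive_nneg f t v -> derive_nneg f t = v.
Proof.
move=> t0 fv; have := within_nneg_proper t0 => pf.
by apply: cvg_lim fv; exact: norm_hausdorff.
Qed.

Lemma is_derive_nnegW {R : realType} {V : normedModType R} {f : R -> V}
    {t : R} {v : V} : is_derive t 1 f v -> is_derive_nneg f t v.
Proof.
case=> df <-; apply: cvg_within_filter.
suff -> : (fun h : R => h^-1 *: (f (t + h) - f t)) =
    (fun h : R => h^-1 *: ((f \o shift t) (h *: (1 : R)) - f t)) by exact: df.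
apply/funext => h; have -> : h *: (1 : R) = h by exact: mulr1.
by rewrite /= [h + t]addrC.
Qed.

Lemma eq_is_derive_nneg {R : realType} {V : normedModType R} {f g : R -> V}
    {t : R} {v : V} : (forall x, 0 <= x -> f x = g x) -> 0 <= t ->
  is_derive_nneg f t v -> is_derive_nneg g t v.
Proof.
move=> fg t0; apply: cvg_trans; apply: fmap_within_eq => h /set_mem/= th.
by rewrite !fg.
Qed.

Lemma is_derive_nneg_line {R : realType} {V : normedModType R} {s : R -> R}
    {t ds : R} (a b : V) :
  is_derive_nneg s t ds ->
  is_derive_nneg (fun u => a + s u *: b) t (ds *: b).
Proof.
move=> sd; rewrite /is_derive_nneg.
under eq_fun do rewrite opprD addrACA subrr add0r -scalerBl scalerA.
exact: cvgZr_tmp.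
Qed.

Lemma derive_nneg_horner {R : realType} {p : {poly R}} {f : R -> R} {x : R} :
  (forall y, 0 <= y -> f y = p.[y]) -> 0 <= x ->
  is_derive_nneg f x p^`().[x].
Proof.
move=> fp x0; have := is_derive_nnegW (is_derive_poly p x).
by apply: eq_is_derive_nneg x0 => y /fp ->.
Qed.

Lemma derive_nneg_hornerE {R : realType} {p : {poly R}} {f : R -> R} {x : R} :
  (forall y, 0 <= y -> f y = p.[y]) -> 0 <= x ->
  derive_nneg f x = p^`().[x].
Proof. by move=> fp x0; exact/derive_nneg_val/derive_nneg_horner. Qed.

Lemma C2_nneg_horner {R : realType} (p : {poly R}) : C2_nneg (horner p).
Proof.
have d1 y : 0 <= y -> derive_nneg (horner p) y = p^`().[y].
  exact: derive_nneg_hornerE.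
split.
- by move=> x x0; exists p^`().[x]; exact: derive_nneg_horner.
- by move=> x x0; exists p^`()^`().[x]; exact: derive_nneg_horner.
- apply: (@subspace_eq_continuous _ _ _ (horner p^`()^`())).
    by move=> x /set_mem/= x0; exact/esym/(derive_nneg_hornerE d1).
  exact/continuous_subspaceT/continuous_horner.
Qed.

Lemma horner_ge0 {R : realType} {p : {poly R}} {x : R} :
  (forall k, 0 <= p`_k) -> 0 <= x -> 0 <= p.[x].
Proof.
by move=> p0 x0; rewrite horner_coef sumr_ge0// => i _; rewrite mulr_ge0// exprn_ge0.
Qed.

Lemma coef_deriv_ge0 {R : realType} {p : {poly R}} :
  (forall k, 0 <= p`_k) -> forall k, 0 <= p^`()`_k.
Proof. by move=> p0 k; rewrite coef_deriv mulrn_wge0. Qed.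

(** * Regularized best responses on a segment *)

Definition segment_set {R : realType} {m : nat} (a b : 'rV[R]_m) :
    set 'rV[R]_m :=
  (fun s : R => a + s *: b) @` `[-1, 1].

Lemma segment_setP {R : realType} {m : nat} {a b y : 'rV[R]_m} :
  segment_set a b y <-> exists2 s, -1 <= s <= 1 & y = a + s *: b.
Proof.
split=> [[s s1 <-]|[s s1 ->]]; exists s => //.
Qed.

Definition clip {R : realType} (v : R) : R := Num.max (-1) (Num.min 1 v).

Lemma clip_itv {R : realType} (v : R) : -1 <= clip v <= 1.
Proof. by rewrite /clip le_max lexx/= ge_max ge_min lexx andbT; lra. Qed.

(** The variational inequality that characterizes the projection onto [[-1, 1]];
it turns a quadratic function of the parameter into a strict minimum. *)
Lemma clip_projection {R : realType} (v s : R) :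
  -1 <= s <= 1 -> 0 <= (s - clip v) * (clip v - v).
Proof.
move=> s1; rewrite /clip.
case: (leP 1 v) => [v1|v1].
  by rewrite max_r; nra.
by case: (leP (-1) v) => [_|v1']; [rewrite subrr mulr0 | nra].
Qed.

Lemma continuous_clip {R : realType} : continuous (@clip R).
Proof.
move=> x; apply: (@continuous_max R R (cst (-1)) (fun v => Num.min 1 v)).
  exact: cst_continuous.
apply: (@continuous_min R R (cst 1) id) => //; exact: cst_continuous.
Qed.

Lemma segment_set_nonempty {R : realType} {m : nat} (a b : 'rV[R]_m) :
  segment_set a b !=set0.
Proof. by exists (a + 0 *: b); apply/segment_setP; exists 0 => //; lra. Qed.

Lemma segment_set_compact {R : realType} {m : nat} (a b : 'rV[R]_m) :
  compact (segment_set a b).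
Proof.
apply: continuous_compact; last exact: segment_compact.
apply: continuous_subspaceT => s.
apply: cvgD; first exact: cvg_cst.
by apply: cvgZr_tmp; exact: cvg_id.
Qed.

Lemma segment_set_convex {R : realType} {m : nat} (a b : 'rV[R]_m) :
  convex_set (M := 'rV[R]_m) (segment_set a b).
Proof.
move=> x y l /set_mem/segment_setP[s s1 ->] /set_mem/segment_setP[u u1 ->].
apply/mem_set/segment_setP.
have l0 : 0 <= l%:num by [].
have l1 : l%:num <= 1 by [].
exists (l%:num * s + (1 - l%:num) * u); first nra.
change (l%:num *: (a + s *: b) + (1 - l%:num) *: (a + u *: b) =
  a + (l%:num * s + (1 - l%:num) * u) *: b).
by apply/rowP => j; rewrite !mxE; ring.
Qed.

Lemma dotv_line {R : realType} {m : nat} (z a b : 'rV[R]_m) (s : R) :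
  dotv z (a + s *: b) = dotv z a + s * dotv z b.
Proof.
rewrite /dotv mulr_sumr -big_split/=; apply: eq_bigr => e _.
by rewrite !mxE; ring.
Qed.

Lemma dotvC {R : realType} {m : nat} (u v : 'rV[R]_m) : dotv u v = dotv v u.
Proof. by apply: eq_bigr => e _; rewrite mulrC. Qed.

(** In the parameter [s] the regularized cost is a parabola of leading
coefficient [eta |b|^2 / 2] whose vertex is the argument of [clip], so its
minimizer on [[-1, 1]] is the projection of that vertex. *)
Lemma argmin_segment {R : realType} {m : nat} (eta : R) (z a b : 'rV[R]_m) :
  0 < eta -> 0 < dotv b b ->
  argmin (segment_set a b) (fun y => dotv z y + eta / 2 * dotv y y) =
  [set a + clip (- (dotv z b + eta * dotv a b) / (eta * dotv b b)) *: b].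
Proof.
move=> eta0 b0; set v := - (_ + _) / _; set N := eta * dotv b b.
have N0 : 0 < N by rewrite mulr_gt0.
pose phi y := dotv z y + eta / 2 * dotv y y.
have vN : dotv z b = - (v * N) - eta * dotv a b.
  by rewrite /v mulfVK ?gt_eqF//; ring.
(* Quadratic growth around the projected vertex gives both minimality and
   uniqueness. *)
have gap s : -1 <= s <= 1 -> phi (a + clip v *: b) +
    N / 2 * (s - clip v) ^+ 2 <= phi (a + s *: b).
  move=> s1; rewrite -subr_ge0.
  have -> : phi (a + s *: b) - (phi (a + clip v *: b) +
      N / 2 * (s - clip v) ^+ 2) = N * ((s - clip v) * (clip v - v)).
    rewrite /phi !dotv_line ![dotv (a + _) _]dotvC !dotv_line (dotvC b a) vN /N.
    by field.
  by rewrite mulr_ge0 ?clip_projection// ltW.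
apply/seteqP; split=> [_ [/segment_setP[s s1 ->] smin]|_ ->].
- have cv : segment_set a b (a + clip v *: b).
    by apply/segment_setP; exists (clip v); rewrite ?clip_itv.
  have := gap s s1; have := smin _ cv; rewrite -!/(phi _) => h1 h2.
  have : N / 2 * (s - clip v) ^+ 2 <= 0 by lra.
  rewrite pmulr_rle0 ?divr_gt0// => h.
  have /eqP : (s - clip v) ^+ 2 = 0 by apply/eqP; rewrite eq_le h sqr_ge0.
  by rewrite sqrf_eq0 subr_eq0 => /eqP ->.
- split; first by apply/segment_setP; exists (clip v); rewrite ?clip_itv.
  move=> _ /segment_setP[s s1 ->]; apply: le_trans (gap s s1).
  by rewrite -/(phi _) lerDl mulr_ge0 ?sqr_ge0// divr_ge0// ltW.
Qed.

(** * Games on segments and their diagonal *)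

Lemma segment_set_ge0 {R : realType} {m : nat} {a b y : 'rV[R]_m} (e : 'I_m) :
  `|b 0 e| <= a 0 e -> segment_set a b y -> 0 <= y 0 e.
Proof.
move=> ba /segment_setP[s /andP[s0 s1] ->]; rewrite !mxE.
by move: ba; rewrite ler_norml => /andP[b0 b1]; nra.
Qed.

Lemma segment_rows_ge0 {R : realType} {n m : nat} {A B : 'M[R]_(n, m)} :
  (forall i e, `|B i e| <= A i e) ->
  forall i y e, segment_set (row i A) (row i B) y -> 0 <= y 0 e.
Proof. by move=> AB i y e; apply: segment_set_ge0; rewrite !mxE. Qed.

Lemma horner_derive_ge0 {R : realType} {m : nat} {p : 'I_m -> {poly R}} :
  (forall e k, 0 <= (p e)`_k) ->
  forall e (x : R), 0 <= x -> 0 <= derive_nneg (horner (p e)) x.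
Proof.
move=> p0 e x x0; rewrite (derive_nneg_hornerE (p := p e) _ x0)//.
exact/horner_ge0/x0/coef_deriv_ge0.
Qed.

Lemma horner_marginal_ge0 {R : realType} {m : nat} {p : 'I_m -> {poly R}} :
  (forall e k, 0 <= (p e)`_k) ->
  forall e (x : R), 0 <= x -> 0 <= 2 * derive_nneg (horner (p e)) x
    + x * derive_nneg (derive_nneg (horner (p e))) x.
Proof.
move=> p0 e x x0; rewrite addr_ge0// mulr_ge0 ?(horner_derive_ge0 p0)//.
rewrite (derive_nneg_hornerE (p := (p e)^`()) _ x0).
  by apply: horner_ge0 => //; do 2 apply: coef_deriv_ge0.
by move=> y y0; rewrite (derive_nneg_hornerE (p := p e) _ y0).
Qed.

Definition segment_game {R : realType} {n m : nat} {A B : 'M[R]_(n, m)}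
    {p : 'I_m -> {poly R}} (AB : forall i e, `|B i e| <= A i e)
    (p0 : forall e k, 0 <= (p e)`_k) : splittable_game R n m :=
  @SplittableGame R n m
    (fun i => segment_set (row i A) (row i B)) (fun e => horner (p e))
    (fun i => segment_set_nonempty _ _) (fun i => @segment_set_convex R m _ _)
    (fun i => segment_set_compact _ _) (segment_rows_ge0 AB)
    (fun e => C2_nneg_horner (p e)) (horner_derive_ge0 p0)
    (horner_marginal_ge0 p0).

Section SegmentGame.
Context {R : realType} {n m : nat} {A B : 'M[R]_(n, m)} {p : 'I_m -> {poly R}}.
Context (AB : forall i e, `|B i e| <= A i e) (p0 : forall e k, 0 <= (p e)`_k).
Let G := segment_game AB p0.

Lemma diagonal_profile (s : R) : -1 <= s <= 1 -> profiles G (A + s *: B).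
Proof. by move=> s1 i; apply/segment_setP; exists s; rewrite // linearD linearZ. Qed.

Lemma marginal_costE (x : 'M[R]_(n, m)) i e : 0 <= load x e ->
  marginal_cost G x i e = (p e).[load x e] + x i e * (p e)^`().[load x e].
Proof. by move=> x0; rewrite mxE/= (derive_nneg_hornerE (p := p e) _ x0). Qed.

(** A common vertex [v] for all players keeps the best response on the diagonal:
this is where the symmetry of a game enters. *)
Lemma diagonal_regularized_br (eta v : R) (z : 'M[R]_(n, m)) : 0 < eta ->
  (forall i, 0 < dotv (row i B) (row i B)) ->
  (forall i, - (dotv (row i z) (row i B) + eta * dotv (row i A) (row i B)) /
    (eta * dotv (row i B) (row i B)) = v) ->
  regularized_br G eta z = A + clip v *: B.
Proof.
move=> eta0 B0 zv; apply/row_matrixP => i; rewrite rowK linearD linearZ/=.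
rewrite /regularized_br_player argmin_segment// zv.
by case: xgetP => [y _ ->//|/(_ _ erefl)].
Qed.

(** Affine combinations stay on the lines that carry the segments, and on such a
line the coordinate [e], where the direction is 1, reads off the parameter; so
the profiles of the hull at distance less than 1 from [A] have parameters in
[[-1, 1]]. *)
Lemma relint_segment_game (e : 'I_m) :
  (forall i, B i e = 1) -> relint (profiles G) A.
Proof.
move=> Be; split; first by have := @diagonal_profile 0; rewrite scale0r addr0; apply; lra.
apply/nbhs_ballP; exists 1 => //= y [_ yA] [k [w [q [qG w1 yE]]]] i.
pose s j := q j i e - A i e.
have qE j : row i (q j) = row i A + s j *: row i B.
  have /segment_setP[u _ qu] := qG j i.
  suff -> : s j = u by [].
  have /rowP/(_ e) := qu; rewrite !mxE Be /s => ->; ring.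
have yE' : row i y = row i A + (\sum_(j < k) w j * s j) *: row i B.
  rewrite yE linear_sum/=.
  under eq_bigr do rewrite linearZ/= qE scalerDr scalerA.
  by rewrite big_split/= -!scaler_suml w1 scale1r.
apply/segment_setP; exists (\sum_(j < k) w j * s j) => //.
have := yA i e; rewrite -ball_normE/=.
have /rowP/(_ e) := yE'; rewrite !mxE Be mulr1 => ->.
rewrite opprD addNKr normrN => /ltW; by rewrite ler_norml.
Qed.

Lemma diagonal_FW_solution (eta : R) (g s : R -> R) :
  (forall u, -1 <= u <= 1 ->
    regularized_br G eta (marginal_cost G (A + u *: B)) = A + clip (g u) *: B) ->
  (forall t, 0 <= t ->
    -1 <= s t <= 1 /\ is_derive t 1 s (clip (g (s t)) - s t)) ->
  FW_solution G eta (fun t => A + s t *: B).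
Proof.
move=> brg sd t t0; have [s1 dst] := sd t t0; split; first exact: diagonal_profile.
rewrite brg// opprD addrACA subrr add0r -scalerBl.
exact/is_derive_nneg_line/is_derive_nnegW.
Qed.

(** The neighbourhood that solutions leave is cut out by a player's coordinate
[e], which on the diagonal is the parameter up to translation: it excludes
parameter [1/2], and a diagonal solution started at any small [s0 > 0] gets
there. *)
Lemma diagonal_unstable (eta : R) (g : R -> R) (e : 'I_m) :
  (forall i, B i e = 1) -> (0 < n)%N ->
  (forall u, -1 <= u <= 1 ->
    regularized_br G eta (marginal_cost G (A + u *: B)) = A + clip (g u) *: B) ->
  continuous g -> (forall u, 0 < u < 1 -> u < g u) ->
  ~ lyapunov_stable G eta A.
Proof.
move=> Be n0 brg cg gu stable; pose i := Ordinal n0.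
pose U := profiles G `&` [set x | x i e < A i e + 2^-1].
have [|V [[_ VA] _ VU]] := stable U.
  split; first by move=> x [].
  apply/nbhs_ballP; exists 2^-1 => /=; first by rewrite invr_gt0.
  move=> y [_ yA] yG; split => //=; have := yA i e.
  by rewrite -ball_normE/= ltr_norml => /andP[h _]; lra.
have lineA : (A + s *: B) @[s --> (0 : R)] --> A.
  rewrite -[X in _ --> X]addr0 -[X in _ + X](scale0r B).
  by apply: cvgD; [exact: cvg_cst | apply: cvgZr_tmp; exact: cvg_id].
have /lineA/nbhs_ballP[r /= r0 rV] := VA.
pose s0 := Num.min (r / 2) 4^-1.
have s00 : 0 < s0 by rewrite lt_min; lra.
have s0r : s0 < r by rewrite gt_min; lra.
have s01 : s0 <= 4^-1 by rewrite ge_min lexx orbT.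
have Vs0 : V (A + s0 *: B).
  apply: rV; last by apply: diagonal_profile; lra.
  by rewrite -ball_normE/= sub0r normrN gtr0_norm.
have cF : continuous (fun u => clip (g u) - u).
  move=> u; apply: cvgB; last exact: cvg_id.
  exact: continuous_comp (cg u) (continuous_clip _).
have F01 u : 0 < u < 1 -> 0 < clip (g u) - u <= 1 - u.
  move=> u1; have /andP[_ c1] := clip_itv (g u).
  rewrite subr_gt0 lerD2r c1 andbT /clip lt_max lt_min gu//.
  by case/andP: u1 => _ ->; rewrite orbT.
have [|s [sE sd shit]] := @scalar_flow _ _ s0 cF F01; first lra.
have [|t t0 st] := shit 2^-1; first lra.
have [||_ /=] := VU (fun t => A + s t *: B) _ _ t t0.
- apply: diagonal_FW_solution brg _ => u /sd[su dsu]; split => //; lra.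
- by rewrite sE.
- by rewrite !mxE Be mulr1 st ltxx.
Qed.

End SegmentGame.

(** * An unstable three-player game of degree six *)

(** Resource [i < 3] is owned by player [i].  On the fourth resource 38 is chosen
so that offset and direction of a player are orthogonal
([- 40 + 1 + 1 + 38 = 0]), which removes the regularization from the
equilibrium condition. *)
Definition offset (R : realType) : 'M[R]_(3, 4) :=
  \matrix_(i, e) if val e == 3 then 38 else if val i == val e then 40 else 1.

Definition direction (R : realType) : 'M[R]_(3, 4) :=
  \matrix_(i, e) if val i == val e then -1 else 1.

(** The constant is the opposite of the directional marginal cost
[42^6 + 6 * 42^5 * (- 40 + 1 + 1)] of the three power costs at the rest point,
where the load is 42. *)
Definition cost_poly (R : realType) (e : 'I_4) : {poly R} :=
  if val e == 3 then (186 * 42 ^+ 5)%:P else 'X^6.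

Lemma direction_le_offset {R : realType} i e :
  `|direction R i e| <= offset R i e.
Proof.
rewrite !mxE; case: (val e == 3); case: (val i == val e);
  rewrite ?normrN normr1; lra.
Qed.

Lemma cost_poly_ge0 {R : realType} e k : 0 <= (cost_poly R e)`_k.
Proof.
rewrite /cost_poly; case: ifP => _; last by rewrite coefXn.
by rewrite coefC; case: ifP => // _; rewrite mulr_ge0 ?exprn_ge0.
Qed.

(** The vertex of the best response at parameter [s], for [eta = 1] and directions
of squared length 4: with [L = 42 + s], the directional marginal cost is
[L^6 + 6 L^5 (- (40 - s) + 2 (1 + s)) = - L^5 (186 - 19 s)] plus the constant
[186 * 42^5]. *)
Definition diagonal_response {R : realType} (s : R) : R :=
  ((42 + s) ^+ 5 * (186 - 19 * s) - 186 * 42 ^+ 5) / 4.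

(** Bounding [(42 + s)^5] below by its tangent [42^4 (42 + 5 s)], the
product [(42 + 5 s) (186 - 19 s)] has slope [5 * 186 - 19 * 42 = 132] at 0, which on
[[0, 1]] dominates its quadratic term [- 95 s^2] and leaves slope at least 37. *)
Lemma diagonal_response_gt {R : realType} (s : R) :
  0 < s < 1 -> s < diagonal_response s.
Proof.
move=> /andP[s0 s1]; rewrite /diagonal_response.
have E : (42 + s) ^+ 5 = 42 ^+ 4 * (42 + 5 * s) +
    s ^+ 2 * (10 * 42 ^+ 3 + 10 * 42 ^+ 2 * s + 5 * 42 * s ^+ 2 + s ^+ 3) by ring.
have L : 42 ^+ 4 * (42 + 5 * s) <= (42 + s) ^+ 5.
  rewrite E lerDl mulr_ge0 ?sqr_ge0// !addr_ge0 ?mulr_ge0 ?exprn_ge0 ?ltW//.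
have D : 186 * 42 + 37 * s <= (42 + 5 * s) * (186 - 19 * s) by nra.
have k1 : 1 <= 42 ^+ 4 :> R by rewrite exprn_ege1// ler1n.
have : 42 ^+ 4 * (186 * 42 + 37 * s) <= (42 + s) ^+ 5 * (186 - 19 * s).
  apply: (@le_trans _ _ (42 ^+ 4 * (42 + 5 * s) * (186 - 19 * s))).
    by rewrite -mulrA ler_wpM2l// exprn_ge0.
  by rewrite ler_wpM2r//; lra.
have -> : 186 * 42 ^+ 5 = 42 ^+ 4 * (186 * 42) :> R by ring.
move: (42 ^+ 4) k1 ((42 + s) ^+ 5 * _) => k k1 M; nra.
Qed.

Lemma continuous_diagonal_response {R : realType} :
  continuous (@diagonal_response R).
Proof.
have -> : @diagonal_response R = horner
    ((((42%:P + 'X) ^+ 5) * (186%:P - 19%:P * 'X) - (186 * 42 ^+ 5)%:P) * (4^-1)%:P).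
  by apply/funext => s; rewrite /diagonal_response !hornerE.
exact: continuous_horner.
Qed.

Lemma diagonal_load {R : realType} (s : R) (e : 'I_4) :
  load (offset R + s *: direction R) e =
  if val e == 3 then 114 + 3 * s else 42 + s.
Proof.
rewrite /load !big_ord_recl big_ord0 !mxE.
by case: e => [[|[|[|[|//]]]] ?] /=; ring.
Qed.

Lemma diagonal_marginal_cost {R : realType} (s : R) i :
  -1 <= s <= 1 ->
  dotv (row i (marginal_cost (segment_game direction_le_offset cost_poly_ge0)
    (offset R + s *: direction R))) (row i (direction R)) =
  - (4 * diagonal_response s).
Proof.
move=> s1; rewrite /dotv; under eq_bigr => e _.
  rewrite !(mxE _ _ 0) marginal_costE; first over.
  by rewrite diagonal_load; case: ifP => _; lra.
rewrite !big_ord_recl big_ord0 !diagonal_load !mxE /cost_poly /=.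
rewrite derivC derivXn !hornerE /diagonal_response.
by case: i => [[|[|[|//]]] ?] /=; field.
Qed.

Lemma dotv_direction {R : realType} i :
  dotv (row i (direction R)) (row i (direction R)) = 4.
Proof.
rewrite /dotv !big_ord_recl big_ord0 !mxE.
by case: i => [[|[|[|//]]] ?] /=; ring.
Qed.

Lemma dotv_offset_direction {R : realType} i :
  dotv (row i (offset R)) (row i (direction R)) = 0.
Proof.
rewrite /dotv !big_ord_recl big_ord0 !mxE.
by case: i => [[|[|[|//]]] ?] /=; ring.
Qed.

Theorem corollary3 (R : realType) :
  exists (eta : R) (m : nat) (G : splittable_game R 3 m) (xs : 'M[R]_(3, m)),
    [/\ 0 < eta,
        forall e : 'I_m, exists p : {poly R},
          [/\ (size p <= 7)%N, forall k : nat, 0 <= p`_k &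
              forall x : R, 0 <= x -> cost G e x = p.[x]],
        regularized_equilibrium G eta xs,
        relint (profiles G) xs &
        ~ lyapunov_stable G eta xs].
Proof.
pose G := segment_game (@direction_le_offset R) cost_poly_ge0.
have diagonal_br u : -1 <= u <= 1 ->
    regularized_br G 1 (marginal_cost G (offset R + u *: direction R)) =
    offset R + clip (diagonal_response u) *: direction R.
  move=> u1; apply: diagonal_regularized_br => // i.
    by rewrite dotv_direction.
  by rewrite diagonal_marginal_cost// dotv_offset_direction dotv_direction; field.
have last_direction i : direction R i ord_max = 1.
  by rewrite mxE; case: i => [[|[|[|//]]] ?].
exists 1, 4%N, G, (offset R); split => //.
- move=> e; exists (cost_poly R e); split=> //; last exact: cost_poly_ge0.
  rewrite /cost_poly; case: ifP => _; last by rewrite size_polyXn.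
  by rewrite (leq_trans (size_polyC_leq1 _)).
- have -> : offset R = offset R + 0 *: direction R by rewrite scale0r addr0.
  split; first by apply: diagonal_profile; lra.
  rewrite diagonal_br; last lra.
  have -> : diagonal_response 0 = 0 :> R by rewrite /diagonal_response; field.
  by rewrite /clip min_r ?max_r//; lra.
- exact: relint_segment_game last_direction.
- apply: diagonal_unstable last_direction _ diagonal_br _ _ => //.
    exact: continuous_diagonal_response.
  exact: diagonal_response_gt.
Qed.
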